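(* Let $G$ be a finite group. The lattice maps $\mathrm{Set}^G_{\bullet}:\mathrm{Tr}(G)\rightleftarrows\mathrm{IndCat}(G):\ \to_{\bullet}$, sending a $G$-transfer system $\rightsquigarrow$ to the indexing category $\mathrm{Set}^G_{\rightsquigarrow}$ and an indexing category $\mathcal{D}$ to the $G$-transfer system $\to_{\mathcal{D}}$, are inverse.
   Context: Let $G$ be a finite group and $\mathrm{Sub}(G)$ its set of subgroups. A $G$-transfer system is a partial order $\to$ on $\mathrm{Sub}(G)$ such that: if $K\to H$ then $K\subset H$; if $K\to H$ then $gKg^{-1}\to gHg^{-1}$ for all $g\in G$; if $K\to H$ and $L\subset H$ then $K\cap L\to L$. $\mathrm{Tr}(G)$ is the poset (a lattice) of all $G$-transfer systems under refinement: $\to_1\ \le\ \to_2$ iff $K\to_1H$ implies $K\to_2H$ for all $K,H\subset G$. Let $\mathrm{Set}^G_{fin}$ be the category of finite $G$-sets. An indexing category is a wide (containing all objects), pullback stable (closed under base change along arbitrary maps of $\mathrm{Set}^G_{fin}$), finite coproduct complete subcategory $\mathcal{D}\subset\mathrm{Set}^G_{fin}$ (i.e. $\mathcal{D}$ has all finite coproducts, and they are formed as in $\mathrm{Set}^G_{fin}$). $\mathrm{IndCat}(G)$ is the poset (a lattice) of all indexing categories under inclusion. For a transfer system $\rightsquigarrow$, $\mathrm{Set}^G_{\rightsquigarrow}$ consists of all finite $G$-sets and those morphisms $f:S\to T$ of $\mathrm{Set}^G_{fin}$ such that $G_s\rightsquigarrow G_{f(s)}$ for every $s\in S$ (where $G_x$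 denotes the stabilizer of $x$). For an indexing category $\mathcal{D}$, $K\to_{\mathcal{D}}H$ iff $K\subset H$ and the canonical projection $\pi:G/K\to G/H$, $\pi(gK)=gH$, is in $\mathcal{D}$. *)

(* Defs.v *)
From Corelib Require Import Relation_Definitions.
From HB Require Import structures.
From mathcomp Require Import all_boot all_fingroup boolp.
Set Implicit Arguments. Unset Strict Implicit. Unset Printing Implicit Defensive.
Local Open Scope group_scope.

Section Lattices.

Definition is_meet T (le : relation T) (x y z : T) : Prop :=
  [/\ le z x, le z y & forall w, le w x -> le w y -> le w z].

Definition is_join T (le : relation T) (x y z : T) : Prop :=
  [/\ le x z, le y z & forall w, le x w -> le y w -> le z w].

Definition is_lattice T (le : relation T) : Prop :=
  [/\ Relation_Definitions.order T le,
      forall x y, exists z, is_meet le x y z &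
      forall x y, exists z, is_join le x y z].

Definition is_lattice_map T U (leT : relation T) (leU : relation U)
    (f : T -> U) : Prop :=
  [/\ forall x y, leT x y -> leU (f x) (f y),
      forall x y z, is_meet leT x y z -> is_meet leU (f x) (f y) (f z) &
      forall x y z, is_join leT x y z -> is_join leU (f x) (f y) (f z)].

End Lattices.

Section TransferSystems.
Variable G : finGroupType.

(* [K :^ g^-1] is the conjugate g K g^-1, since [K :^ g] is g^-1 K g. *)
Record is_transfer_system (R : relation {group G}) : Prop := IsTransferSystem {
  ts_order : Relation_Definitions.order _ R;
  ts_sub : forall K H, R K H -> K \subset H;
  ts_conj : forall K H g, R K H -> R (K :^ g^-1)%G (H :^ g^-1)%G;
  ts_restr : forall K H (L : {group G}), R K H -> L \subset H -> R (K :&: L)%G L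
}.

Record Tr : Type := MkTr {
  transfer :> {group G} -> {group G} -> Prop;
  transferP : is_transfer_system transfer
}.

Definition Tr_le (R1 R2 : Tr) : Prop := forall K H, R1 K H -> R2 K H.

End TransferSystems.

Section GSets.
Variable G : finGroupType.

Record gset : Type := GSet {
  gset_sort :> finType;
  gset_act : {action G &-> gset_sort}
}.

(* The library's actions are right actions: the left action of a G-set X is   *)
(* recovered as g . x := x ^ (g^-1).                                          *)
Definition lact (X : gset) (g : G) (x : X) : X := gset_act X x g^-1.

Lemma lact1 (X : gset) (x : X) : lact 1 x = x.
Proof. by rewrite /lact invg1 act1. Qed.

Lemma lactM (X : gset) (g h : G) (x : X) : lact (g * h) x = lact g (lact h x).
Proof. by rewrite /lact invMg actM. Qed.

Definition stab (X : gset) (x : X) : {group G} := 'C[x | gset_act X]%G.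

Lemma stabP (X : gset) (x : X) g : reflect (lact g x = x) (g \in stab x).
Proof. by rewrite -groupV; apply: astab1P. Qed.

Record gmap (X Y : gset) : Type := GMap {
  gmap_fun :> X -> Y;
  gmapP : forall g x, gmap_fun (lact g x) = lact g (gmap_fun x)
}.

Lemma gmap_ext (X Y : gset) (f f' : gmap X Y) : f =1 f' -> f = f'.
Proof.
case: f f' => [f Hf] [f' Hf'] /= /funext E.
by subst f'; congr GMap; apply: Prop_irrelevance.
Qed.

Definition gid (X : gset) : gmap X X := @GMap X X id (fun _ _ => erefl).

Lemma gcomp_subproof (X Y Z : gset) (h : gmap Y Z) (f : gmap X Y) g x :
  (h \o f) (lact g x) = lact g ((h \o f) x).
Proof. by rewrite /= !gmapP. Qed.

Definition gcomp (X Y Z : gset) (h : gmap Y Z) (f : gmap X Y) : gmap X Z :=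
  GMap (gcomp_subproof h f).

Definition morphisms : Type := forall X Y : gset, gmap X Y -> Prop.

Definition all_morphisms : morphisms := fun _ _ _ => True.

(* The square  P --p1--> S                                                    *)
(*             |p2       |f                                                   *)
(*             U --u---> T    is cartesian in the category of finite G-sets.  *)
Definition is_pullback (P S T U : gset) (p1 : gmap P S) (p2 : gmap P U)
    (f : gmap S T) (u : gmap U T) : Prop :=
  gcomp f p1 = gcomp u p2 /\
  forall (Z : gset) (a : gmap Z S) (b : gmap Z U), gcomp f a = gcomp u b ->
    exists! h : gmap Z P, gcomp p1 h = a /\ gcomp p2 h = b.

(* (C, inj) is a coproduct of the X i in the wide subcategory D.              *)
Definition is_coproduct (D : morphisms) (I : finType) (X : I -> gset)
    (C : gset) (inj : forall i, gmap (X i) C) : Prop :=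
  (forall i, D _ _ (inj i)) /\
  forall (Z : gset) (f : forall i, gmap (X i) Z), (forall i, D _ _ (f i)) ->
    exists! h : gmap C Z, D _ _ h /\ forall i, gcomp h (inj i) = f i.

Record is_indexing_category (D : morphisms) : Prop := IsIndexingCategory {
  ic_id : forall X, D _ _ (gid X);
  ic_comp : forall X Y Z (h : gmap Y Z) (f : gmap X Y),
    D _ _ h -> D _ _ f -> D _ _ (gcomp h f);
  ic_pullback : forall P S T U (p1 : gmap P S) (p2 : gmap P U)
      (f : gmap S T) (u : gmap U T),
    is_pullback p1 p2 f u -> D _ _ f -> D _ _ p2;
  ic_coproduct : forall (I : finType) (X : I -> gset),
    exists C (inj : forall i, gmap (X i) C),
      is_coproduct all_morphisms inj /\ is_coproduct D inj
}.

Record IndCat : Type := MkIndCat {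
  indcat :> forall X Y : gset, gmap X Y -> Prop;
  indcatP : is_indexing_category indcat
}.

Definition IndCat_le (D1 D2 : IndCat) : Prop :=
  forall X Y (f : gmap X Y), D1 _ _ f -> D2 _ _ f.

End GSets.

Section Orbits.
Variable G : finGroupType.
Implicit Types (K H L : {group G}) (g : G).

Definition coset_type K : finType :=
  {A : {set G} | A \in lcosets K [set: G]}.

Lemma mem_coset K g : g *: K \in lcosets K [set: G].
Proof. by apply/lcosetsP; exists g; rewrite ?inE. Qed.

Definition mkcoset K g : coset_type K := exist _ (g *: K) (mem_coset K g).

Lemma cosetP K (A : coset_type K) : exists g, A = mkcoset K g.
Proof.
by case/lcosetsP: (valP A) => g _ E; exists g; apply: val_inj.
Qed.

Lemma coset_act_subproof K (A : coset_type K) g :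
  g^-1 *: val A \in lcosets K [set: G].
Proof. by case: (cosetP A) => x ->; rewrite -lcosetM mem_coset. Qed.

Definition coset_act K (A : coset_type K) g : coset_type K :=
  exist _ (g^-1 *: val A) (coset_act_subproof A g).

Lemma coset_act1 K : (@coset_act K)^~ 1 =1 id.
Proof. by move=> A; apply: val_inj; rewrite /= invg1 lcoset1. Qed.

Lemma coset_actM K : forall A, act_morph (@coset_act K) A.
Proof. by move=> A g h; apply: val_inj; rewrite /= invMg lcosetM. Qed.

(* G/K, with g . (x K) = (g x) K *)
Definition orb K : gset G :=
  GSet (TotalAction (@coset_act1 K) (@coset_actM K)).

Lemma lact_coset K g x : lact g (mkcoset K x : orb K) = mkcoset K (g * x).
Proof. by apply: val_inj; rewrite /= invgK lcosetM. Qed.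

Lemma proj_fun_subproof K H (sKH : K \subset H) (A : orb K) :
  val A * H \in lcosets H [set: G].
Proof.
by case: (cosetP A) => x -> /=; rewrite -mulgA (mulSGid sKH) mem_coset.
Qed.

Definition proj_fun K H (sKH : K \subset H) (A : orb K) : orb H :=
  exist _ (val A * H) (proj_fun_subproof sKH A).

Lemma proj_funE K H (sKH : K \subset H) g :
  proj_fun sKH (mkcoset K g) = mkcoset H g.
Proof. by apply: val_inj; rewrite /= -mulgA (mulSGid sKH). Qed.

Lemma proj_subproof K H (sKH : K \subset H) g (A : orb K) :
  proj_fun sKH (lact g A) = lact g (proj_fun sKH A).
Proof. by case: (cosetP A) => x ->; rewrite lact_coset !proj_funE lact_coset. Qed.

(* By [proj_funE], pi (g K) = g H. *)
Definition proj K H (sKH : K \subset H) : gmap (orb K) (orb H) :=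
  GMap (proj_subproof sKH).

End Orbits.

Section SetOfTransfer.
Variable G : finGroupType.
Implicit Types (X Y Z : gset G).

Lemma reg_act1 : (fun x g : G => g^-1 * x)^~ 1 =1 id.
Proof. by move=> x; rewrite /= invg1 mul1g. Qed.

Lemma reg_actM (x : G) : act_morph (fun x g : G => g^-1 * x) x.
Proof. by move=> g h; rewrite /= invMg mulgA. Qed.

Definition reg : gset G := GSet (TotalAction reg_act1 reg_actM).

Lemma reg_map_subproof X (x : X) g (h : reg) :
  lact (lact g h : G) x = lact g (lact (h : G) x).
Proof. by rewrite -lactM /lact /= invgK. Qed.

Definition reg_map X (x : X) : gmap reg X := GMap (reg_map_subproof x).

Lemma pullback_inj (P S T U : gset G) (p1 : gmap P S) (p2 : gmap P U)
    (f : gmap S T) (u : gmap U T) (x y : P) :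
  is_pullback p1 p2 f u -> p1 x = p1 y -> p2 x = p2 y -> x = y.
Proof.
case=> E pbP E1 E2.
have e1 : gcomp p1 (reg_map y) = gcomp p1 (reg_map x).
  by apply: gmap_ext => h /=; rewrite !gmapP E1.
have e2 : gcomp p2 (reg_map y) = gcomp p2 (reg_map x).
  by apply: gmap_ext => h /=; rewrite !gmapP E2.
have [|h [_ uniq_h]] := pbP _ (gcomp p1 (reg_map x)) (gcomp p2 (reg_map x)).
  by apply: gmap_ext => z; apply: (congr1 (fun k : gmap P T => k _) E).
have e : reg_map x = reg_map y.
  by rewrite -(uniq_h (reg_map x)) //; apply: uniq_h (conj e1 e2).
by have := congr1 (fun k : gmap reg P => k (1 : G)) e; rewrite /= !lact1.
Qed.

Lemma stab_sub X Y (f : gmap X Y) (x : X) : stab x \subset stab (f x).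
Proof.
by apply/subsetP=> g /stabP gx; apply/stabP; rewrite -gmapP gx.
Qed.

Lemma stab_inj X Y (f : gmap X Y) (x : X) :
  injective f -> stab (f x) = stab x.
Proof.
move=> f_inj; apply/val_inj/setP=> g; apply/stabP/stabP; rewrite -gmapP.
  exact: f_inj.
by move=> ->.
Qed.

Section Sum.
Variables (I : finType) (X : I -> gset G).

Definition sum_act (p : {i : I & X i}) (g : G) : {i : I & X i} :=
  Tagged (fun i => gset_sort (X i)) (gset_act (X (tag p)) (tagged p) g).

Lemma sum_act1 : sum_act^~ 1 =1 id.
Proof. by case=> i x; rewrite /sum_act /= act1. Qed.

Lemma sum_actM p : act_morph sum_act p.
Proof. by move=> g h; rewrite /sum_act /= actM. Qed.

Definition gsum : gset G := GSet (TotalAction sum_act1 sum_actM).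

Definition gsum_inj i : gmap (X i) gsum :=
  @GMap G (X i) gsum (fun x => Tagged (fun i => gset_sort (X i)) x)
    (fun _ _ => erefl).

Lemma gsum_inj_inj i : injective (gsum_inj i).
Proof. exact: eq_from_Tagged. Qed.

Lemma gsum_case_subproof Z (f : forall i, gmap (X i) Z) g (p : gsum) :
  f (tag (lact g p)) (tagged (lact g p)) = lact g (f (tag p) (tagged p)).
Proof. exact: gmapP. Qed.

Definition gsum_case Z (f : forall i, gmap (X i) Z) : gmap gsum Z :=
  GMap (gsum_case_subproof f).

Lemma gsum_coproduct (D : morphisms G) :
  (forall i, D _ _ (gsum_inj i)) ->
  (forall Z (f : forall i, gmap (X i) Z), (forall i, D _ _ (f i)) ->
     D _ _ (gsum_case f)) ->
  is_coproduct D gsum_inj.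
Proof.
move=> Dinj Dcase; split=> // Z f Df; exists (gsum_case f); split.
  by split=> [|i]; [apply: Dcase | apply: gmap_ext].
move=> h [_ Eh]; apply: gmap_ext => -[i x] /=.
by rewrite -(Eh i).
Qed.

End Sum.

Definition SetG_mor (R : Tr G) : morphisms G :=
  fun S T f => forall s : S, R (stab s) (stab (f s)).

Lemma SetG_subproof (R : Tr G) : is_indexing_category (SetG_mor R).
Proof.
have [[Rxx Rtr _] Rsub _ Rres] := transferP R.
split=> [X x|X Y Z h f Rh Rf x|P S T U p1 p2 f u pb Rf x|I X].
- exact: Rxx.
- exact: Rtr (Rf x) (Rh (f x)).
- have Ex : f (p1 x) = u (p2 x).
    by case: pb => E _; apply: (congr1 (fun k : gmap P T => k x) E).
  have -> : stab x = (stab (p1 x) :&: stab (p2 x))%G.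
    apply/val_inj/eqP; rewrite /= eqEsubset subsetI !stab_sub /=.
    apply/subsetP=> g; rewrite inE => /andP[/stabP g1 /stabP g2].
    by apply/stabP/(pullback_inj pb); rewrite gmapP.
  by apply: Rres (Rf (p1 x)) _; rewrite Ex stab_sub.
- exists (gsum X), (gsum_inj X); split; apply: gsum_coproduct => //.
    by move=> i x; rewrite (stab_inj _ (@gsum_inj_inj _ X i)); apply: Rxx.
  move=> Z f Rf [i x].
  by rewrite (stab_inj x (@gsum_inj_inj _ X i)); apply: Rf.
Qed.

Definition SetG (R : Tr G) : IndCat G := MkIndCat (SetG_subproof R).

End SetOfTransfer.

Section TransferOfInd.
Variable G : finGroupType.
Implicit Types (X Y Z : gset G) (K H L : {group G}).

Section Pullback.
Variables (S T U : gset G) (f : gmap S T) (u : gmap U T).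

Definition pb_type : finType := {p : S * U | f p.1 == u p.2}.

Lemma pb_act_subproof (p : pb_type) g :
  f (gset_act S (val p).1 g) == u (gset_act U (val p).2 g).
Proof.
case: p => -[s x] /= /eqP E.
by have := gmapP f g^-1 s; have := gmapP u g^-1 x; rewrite /lact invgK => -> ->; rewrite E.
Qed.

Definition pb_act (p : pb_type) g : pb_type :=
  exist _ (gset_act S (val p).1 g, gset_act U (val p).2 g) (pb_act_subproof p g).

Lemma pb_act1 : pb_act^~ 1 =1 id.
Proof. by move=> [[s x] ?]; apply: val_inj; rewrite /= !act1. Qed.

Lemma pb_actM p : act_morph pb_act p.
Proof. by move=> g h; apply: val_inj; rewrite /= !actM. Qed.

Definition gpb : gset G := GSet (TotalAction pb_act1 pb_actM).

Definition pb_fst : gmap gpb S :=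
  @GMap G gpb S (fun p => (val p).1) (fun _ _ => erefl).

Definition pb_snd : gmap gpb U :=
  @GMap G gpb U (fun p => (val p).2) (fun _ _ => erefl).

Section Pair.
Variables (Z : gset G) (a : gmap Z S) (b : gmap Z U).
Hypothesis E : gcomp f a = gcomp u b.

Lemma pb_pair_subproof z : f (a z, b z).1 == u (a z, b z).2.
Proof. by apply/eqP; apply: (congr1 (fun k : gmap _ _ => k z) E). Qed.

Definition pb_pair_fun z : gpb := exist _ (a z, b z) (pb_pair_subproof z).

Lemma pb_pairP g z : pb_pair_fun (lact g z) = lact g (pb_pair_fun z).
Proof. by apply: val_inj; rewrite /= !gmapP. Qed.

Definition pb_pair : gmap Z gpb := GMap pb_pairP.
End Pair.

Lemma gpbP : is_pullback pb_fst pb_snd f u.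
Proof.
split=> [|Z a b E]; first by apply: gmap_ext => -[p /= /eqP].
exists (pb_pair E); split; first by split; apply: gmap_ext.
move=> h [E1 E2]; apply: gmap_ext => z; apply: val_inj.
by rewrite /= -E1 -E2 -surjective_pairing.
Qed.
End Pullback.

Section IndexingCategory.
Variable D : IndCat G.

Lemma iso_indcat X Y (f : gmap X Y) (f' : gmap Y X) :
  gcomp f f' = gid Y -> gcomp f' f = gid X -> D _ _ f.
Proof.
move=> fK f'K; have [Did _ Dpb _] := indcatP D.
apply: (Dpb _ _ _ _ (gcomp f' f) f (gid X) f') (Did X); split.
  exact: gmap_ext.
move=> Z a b E; exists a; split.
  split; first by apply: gmap_ext => z; rewrite f'K.
  rewrite (_ : a = gcomp f' b); last by rewrite -E; apply: gmap_ext.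
  apply: gmap_ext => z.
  exact: (congr1 (fun k : gmap _ _ => k (b z)) fK).
by move=> h [<- _]; rewrite f'K; apply: gmap_ext.
Qed.

Lemma coproduct_inj_indcat (I : finType) (X : I -> gset G) C
    (inj : forall i, gmap (X i) C) :
  is_coproduct (all_morphisms (G := G)) inj -> forall i, D _ _ (inj i).
Proof.
move=> [_ copC] i; have [_ Dcomp _ Dco] := indcatP D.
have [C' [inj' [[_ copC'] [Dinj' _]]]] := Dco I X.
have [h [[_ Eh] _]] := copC C' inj' (fun _ => Logic.I).
have [h' [[_ Eh'] _]] := copC' C inj (fun _ => Logic.I).
rewrite -Eh'; apply: Dcomp => //; apply: (@iso_indcat _ _ _ h).
  have [k [_ uniq_k]] := copC C inj (fun _ => Logic.I).
  rewrite -(uniq_k (gid C)); last by split=> // j; apply: gmap_ext.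
  symmetry; apply: uniq_k; split=> // j.
  by rewrite -[RHS]Eh' -[in RHS]Eh; apply: gmap_ext.
have [k [_ uniq_k]] := copC' C' inj' (fun _ => Logic.I).
rewrite -(uniq_k (gid C')); last by split=> // j; apply: gmap_ext.
symmetry; apply: uniq_k; split=> // j.
by rewrite -[RHS]Eh -[in RHS]Eh'; apply: gmap_ext.
Qed.

Section Injective.
Variables (X Y : gset G) (m : gmap X Y).
Hypothesis m_inj : injective m.

Definition im_type (b : bool) : finType := {y : Y | (y \in codom m) == b}.

Lemma codom_act (y : Y) g : (gset_act Y y g \in codom m) = (y \in codom m).
Proof.
suff H z h : z \in codom m -> gset_act Y z h \in codom m.
  by apply/idP/idP=> [/(H _ g^-1)|/H//]; rewrite actK.
case/codomP=> x ->; have := gmapP m h^-1 x; rewrite /lact invgK => <-.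
exact: codom_f.
Qed.

Lemma im_act_subproof b (y : im_type b) g :
  (gset_act Y (val y) g \in codom m) == b.
Proof. by rewrite codom_act (valP y). Qed.

Definition im_act b (y : im_type b) g : im_type b :=
  exist _ (gset_act Y (val y) g) (im_act_subproof y g).

Lemma im_act1 b : (@im_act b)^~ 1 =1 id.
Proof. by move=> y; apply: val_inj; rewrite /= act1. Qed.

Lemma im_actM b y : act_morph (@im_act b) y.
Proof. by move=> g h; apply: val_inj; rewrite /= actM. Qed.

Definition gim b : gset G := GSet (TotalAction (@im_act1 b) (@im_actM b)).

Definition gim_inj b : gmap (gim b) Y :=
  @GMap G (gim b) Y val (fun _ _ => erefl).

Lemma gim_case_subproof (y : Y) : (y \in codom m) == (y \in codom m).
Proof. exact: eqxx. Qed.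

Definition gim_in (y : Y) : gim (y \in codom m) :=
  exist _ y (gim_case_subproof y).

Lemma gim_inE b (y : gim b) Z (f : forall b, gmap (gim b) Z) :
  f (val y \in codom m) (gim_in (val y)) = f b y.
Proof.
case: y => y yb /=; move: (yb); rewrite -(eqP yb) => yb'.
by congr (f _ _); apply: val_inj.
Qed.

Lemma gim_coproduct : is_coproduct (all_morphisms (G := G)) gim_inj.
Proof.
split=> // Z f _.
have fP g (y : Y) : f _ (gim_in (lact g y)) = lact g (f _ (gim_in y)).
  by rewrite -gmapP -(gim_inE (lact g (gim_in y))).
exists (GMap fP); split.
  by split=> // b; apply: gmap_ext => y; apply: gim_inE.
by move=> h [_ Eh]; apply: gmap_ext => y; rewrite /= -Eh.
Qed.

Lemma mono_indcat : D _ _ m.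
Proof.
have [_ Dcomp _ _] := indcatP D.
have mP x : (m x \in codom m) == true by rewrite codom_f.
pose k_fun x : gim true := exist _ (m x) (mP x).
have kP g x : k_fun (lact g x) = lact g (k_fun x).
  by apply: val_inj; rewrite /= gmapP.
have yP (y : gim true) : val y \in codom m by rewrite (eqP (valP y)).
have k'P g (y : gim true) : iinv (yP (lact g y)) = lact g (iinv (yP y)).
  by apply: m_inj; rewrite gmapP !f_iinv.
rewrite (_ : m = gcomp (gim_inj true) (GMap kP)); last exact: gmap_ext.
apply: Dcomp; first exact: coproduct_inj_indcat gim_coproduct _.
apply: (@iso_indcat _ _ _ (GMap k'P)); apply: gmap_ext => y.
  by apply: val_inj; rewrite /= f_iinv.
by apply: m_inj; rewrite /= f_iinv.
Qed.

End Injective.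

Definition ind_rel : relation {group G} :=
  fun K H => exists sKH : K \subset H, D _ _ (proj sKH).

Section CosetMap.
Variables (K L : {group G}) (a : G).
Hypothesis sKL : K :^ a \subset L.

Lemma cmap_mul x : (x *: K) * (a *: L) = (x * a) *: L.
Proof.
rewrite lcosetM -mulgA; congr (_ * _).
transitivity (a *: (K :^ a * L)); last by rewrite (mulSGid sKL).
by rewrite conjsgE !mulgA mulg_set1 mulgV mul1g.
Qed.

Lemma cmap_fun_subproof (A : orb K) :
  val A * (a *: L) \in lcosets L [set: G].
Proof. by case: (cosetP A) => x ->; rewrite /= cmap_mul mem_coset. Qed.

Definition cmap_fun (A : orb K) : orb L :=
  exist _ (val A * (a *: L)) (cmap_fun_subproof A).

Lemma cmap_funE x : cmap_fun (mkcoset K x) = mkcoset L (x * a).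
Proof. by apply: val_inj; rewrite /= cmap_mul. Qed.

Lemma cmap_subproof g (A : orb K) :
  cmap_fun (lact g A) = lact g (cmap_fun A).
Proof.
by case: (cosetP A) => x ->; rewrite lact_coset !cmap_funE lact_coset mulgA.
Qed.

Definition cmap : gmap (orb K) (orb L) := GMap cmap_subproof.
End CosetMap.

Lemma mkcoset_eq K x y : (mkcoset K x = mkcoset K y) <-> x^-1 * y \in K.
Proof.
split=> [/(congr1 val) /= E|xy]; first by rewrite -mem_lcoset E lcoset_refl.
by apply: val_inj; apply/lcoset_eqP; rewrite mem_lcoset -groupV invMg invgK.
Qed.

Lemma ind_rel_subproof : is_transfer_system ind_rel.
Proof.
have [Did Dcomp Dpb _] := indcatP D.
have cmapV K H a (s1 : K :^ a \subset H) (s2 : H :^ a^-1 \subset K) :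
    gcomp (cmap s2) (cmap s1) = gid _.
  by apply: gmap_ext => A; case: (cosetP A) => x ->; rewrite /= !cmap_funE mulgK.
split=> [|K H []//|K H g [sKH DKH]|K H L [sKH DKH] sLH].
- split=> [K|K L H [sKL DKL] [sLH DLH]|K H [sKH _] [sHK _]].
  + exists (subxx _); rewrite (_ : proj _ = gid _) //.
    by apply: gmap_ext => A; case: (cosetP A) => x ->; rewrite /= proj_funE.
  + exists (subset_trans sKL sLH).
    rewrite (_ : proj _ = gcomp (proj sLH) (proj sKL)); first exact: Dcomp.
    by apply: gmap_ext => A; case: (cosetP A) => x ->; rewrite /= !proj_funE.
  + by apply/val_inj/eqP; rewrite eqEsubset sKH.
- have sc : (K :^ g^-1)%G \subset (H :^ g^-1)%G by rewrite /= conjSg.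
  exists sc.
  have s1 : (K :^ g^-1)%G :^ g \subset K by rewrite /= conjsgKV.
  have s2 : K :^ g^-1 \subset (K :^ g^-1)%G by [].
  have s3 : H :^ g^-1 \subset (H :^ g^-1)%G by [].
  have s4 : (H :^ g^-1)%G :^ g^-1^-1 \subset H by rewrite invgK /= conjsgKV.
  have s2' : K :^ g^-1^-1^-1 \subset (K :^ g^-1)%G by rewrite invgK.
  have s1' : (K :^ g^-1)%G :^ g^-1^-1 \subset K by rewrite invgK.
  rewrite (_ : proj _ = gcomp (cmap s3) (gcomp (proj sKH) (cmap s1))).
    apply: (Dcomp).
      apply: (@iso_indcat _ _ _ (cmap s4)); last exact: cmapV.
      apply: gmap_ext => A; case: (cosetP A) => x ->.
      by rewrite /= !cmap_funE invgK mulgK.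
    apply: (Dcomp) => //; apply: (@iso_indcat _ _ _ (cmap s2)).
      apply: gmap_ext => A; case: (cosetP A) => x ->.
      by rewrite /= !cmap_funE mulgKV.
    exact: cmapV.
  apply: gmap_ext => A; case: (cosetP A) => x ->.
  by rewrite /= !(proj_funE, cmap_funE) mulgK.
- have sL : (K :&: L)%G \subset L by apply: subsetIr.
  have sK : (K :&: L)%G \subset K by apply: subsetIl.
  exists sL.
  have E : gcomp (proj sKH) (proj sK) = gcomp (proj sLH) (proj sL).
    by apply: gmap_ext => A; case: (cosetP A) => x ->; rewrite /= !proj_funE.
  rewrite (_ : proj sL = gcomp (pb_snd _ _) (pb_pair E)); last exact: gmap_ext.
  apply: (Dcomp); first exact: Dpb (gpbP _ _) DKH.
  apply: mono_indcat => A B; case: (cosetP A) => x ->; case: (cosetP B) => y ->.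
  move=> /(congr1 val) /= []; rewrite -!(mulgA [set _]).
  rewrite !(mulSGid sK) !(mulSGid sL) => eK eL.
  apply/mkcoset_eq; rewrite inE; apply/andP.
  by split; apply/mkcoset_eq; apply: val_inj.
Qed.

Definition transfer_of : Tr G := MkTr ind_rel_subproof.
End IndexingCategory.
End TransferOfInd.

(* Main.v *)
From Corelib Require Import Relation_Definitions.
From mathcomp Require Import all_boot all_fingroup boolp.
Require Import Defs.
Set Implicit Arguments. Unset Strict Implicit. Unset Printing Implicit Defensive.
Local Open Scope group_scope.

(** The content of the theorem is that an indexing category D is determined by
    the projections [G/K -> G/H] it contains, and a transfer system by its
    values up to conjugation.

    Every point [x] of a finite G-set [X] gives an embedding [orbit_map x] of
    [G/G_x] into [X], and a map [f : X -> Y] restricts along [orbit_map x] and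
    [orbit_map (f x)] to the projection [G/G_x -> G/G_(f x)].  The claim
    [indcat_stab] is that [f] is in D if and only if all these projections are.
    If [f] is in D, its pullback along [orbit_map (f x)] is in D, and the
    projection is the restriction of that pullback to an embedded copy of
    [G/G_x]; D contains all embeddings ([mono_indcat]).  Conversely, if the
    projections are in D, then so are their composites [G/G_x -> Y] with the
    embeddings [orbit_map (f x)], hence so is the map that they induce on the
    disjoint union of the [G/G_x] over all [x] in [X], because D is closed
    under copairing ([case_indcat]).  Choosing one point in each orbit of [X]
    embeds [X] into this union, and the restriction of the induced map along
    this embedding is [f].  This says that [SetG (transfer_of D) = D].

    In the other direction, the stabilizer of [xK] in [G/K] is the conjugate
    [x K x^-1], so [G/K -> G/H] lies in [SetG R] if and only if R relates all
    [x K x^-1] to [x H x^-1], which means just that it relates [K] to [H].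

    The two assignments are thus mutually inverse monotone maps, that is, an
    order isomorphism, which transports the lattice structure and preserves
    meets and joins.  Transfer systems form a lattice because they are closed
    under intersection and are all contained in the inclusion relation. *)

(** * Order isomorphisms and lattices *)

Section OrderIso.
Variables (T U : Type) (leT : relation T) (leU : relation U).
Variables (f : T -> U) (g : U -> T).
Hypotheses (f_mono : forall x y, leT x y -> leU (f x) (f y))
  (g_mono : forall x y, leU x y -> leT (g x) (g y))
  (fK : cancel f g) (gK : cancel g f).

Lemma iso_meet x y z : is_meet leT x y z -> is_meet leU (f x) (f y) (f z).
Proof.
case=> zx zy zmax; split; try exact: f_mono.
move=> w /g_mono wx /g_mono wy; rewrite -(gK w); apply: f_mono.
by rewrite !fK in wx wy; apply: zmax.
Qed.

Lemma iso_join x y z : is_join leT x y z -> is_join leU (f x) (f y) (f z).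
Proof.
case=> xz yz zmin; split; try exact: f_mono.
move=> w /g_mono xw /g_mono yw; rewrite -(gK w); apply: f_mono.
by rewrite !fK in xw yw; apply: zmin.
Qed.

Lemma iso_lattice_map : is_lattice_map leT leU f.
Proof. by split; [exact: f_mono | exact: iso_meet | exact: iso_join]. Qed.

Lemma iso_lattice : is_lattice leT -> is_lattice leU.
Proof.
case=> [[leTxx leT_trans leT_anti] meetT joinT]; split.
- split=> [x|x y z /g_mono xy /g_mono yz|x y /g_mono xy /g_mono yx].
  + by rewrite -(gK x); apply: f_mono.
  + by rewrite -(gK x) -(gK z); apply/f_mono/(leT_trans _ _ _ xy).
  + by rewrite -(gK x) -(gK y); congr f; apply: leT_anti.
- move=> x y; have [z /iso_meet] := meetT (g x) (g y).
  by rewrite !gK; exists (f z).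
- move=> x y; have [z /iso_join] := joinT (g x) (g y).
  by rewrite !gK; exists (f z).
Qed.

End OrderIso.

(** * The lattice of transfer systems *)

Section TransferLattice.
Variable G : finGroupType.
Implicit Types (R : Tr G) (P : Tr G -> Prop).

Lemma Tr_ext R1 R2 : Tr_le R1 R2 -> Tr_le R2 R1 -> R1 = R2.
Proof.
case: R1 R2 => [R1 P1] [R2 P2] le12 le21.
have E : R1 = R2.
  by apply/funext=> K; apply/funext=> H; apply/propext; split=> [/le12|/le21].
by subst R2; congr MkTr; apply: Prop_irrelevance.
Qed.

Lemma Tr_order : Relation_Definitions.order _ (@Tr_le G).
Proof.
split=> [R K H //|R1 R2 R3 le12 le23 K H /le12/le23 //|R1 R2].
exact: Tr_ext.
Qed.

(** The inclusion [K \subset H] is imposed explicitly so that the empty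
    intersection is the greatest transfer system. *)
Definition Tr_inter_rel P : relation {group G} :=
  fun K H => K \subset H /\ forall R, P R -> R K H.

Lemma Tr_inter_subproof P : is_transfer_system (Tr_inter_rel P).
Proof.
split=> [|K H []//|K H g [sKH RKH]|K H L [sKH RKH] sLH].
- split=> [K|K L H [sKL RKL] [sLH RLH]|K H [sKH _] [sHK _]].
  + by split=> // R _; have [[Rxx _ _] _ _ _] := transferP R; apply: Rxx.
  + split=> [|R PR]; first exact: subset_trans sKL sLH.
    have [[_ Rtr _] _ _ _] := transferP R.
    exact: Rtr (RKL R PR) (RLH R PR).
  + by apply/val_inj/eqP; rewrite eqEsubset sKH.
- split=> [|R PR]; first by rewrite /= conjSg.
  exact: (ts_conj (transferP R)) (RKH R PR).
- split=> [|R PR]; first exact: subsetIr.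
  exact: (ts_restr (transferP R)) (RKH R PR) sLH.
Qed.

Definition Tr_inter P : Tr G := MkTr (Tr_inter_subproof P).

Lemma Tr_inter_le P R : P R -> Tr_le (Tr_inter P) R.
Proof. by move=> PR K H [_]; apply. Qed.

Lemma Tr_inter_glb P R :
  (forall R', P R' -> Tr_le R R') -> Tr_le R (Tr_inter P).
Proof.
move=> leR K H RKH; split=> [|R' PR']; first exact: (ts_sub (transferP R)) RKH.
exact: leR RKH.
Qed.

Lemma Tr_lattice : is_lattice (@Tr_le G).
Proof.
split=> [|R1 R2|R1 R2]; first exact: Tr_order.
- exists (Tr_inter (fun R => R = R1 \/ R = R2)).
  split=> [||R le1 le2]; try by apply: Tr_inter_le; auto.
  by apply: Tr_inter_glb => _ [] ->.
- (* The join is the intersection of all upper bounds. *)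
  exists (Tr_inter (fun R => Tr_le R1 R /\ Tr_le R2 R)).
  split=> [||R le1 le2]; try by apply: Tr_inter_glb => R [].
  exact: Tr_inter_le.
Qed.

End TransferLattice.

(** * Orbits as embedded copies of coset spaces *)

Section OrbitMaps.
Variable G : finGroupType.
Implicit Types (X Y : gset G) (K H : {group G}).

Lemma lact_eq X (x : X) g h :
  lact g x = lact h x <-> g^-1 * h \in stab x.
Proof.
split=> [E|/stabP E]; first by apply/stabP; rewrite lactM -E -lactM mulVg lact1.
by rewrite -[in LHS]E -lactM mulKVg.
Qed.

Lemma stab_mkcoset K x : stab (mkcoset K x : orb K) = (K :^ x^-1)%G.
Proof.
apply/val_inj/setP=> g; rewrite [RHS]mem_conjgV conjgE.
apply/stabP/idP; rewrite lact_coset.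
  by move/esym/mkcoset_eq.
by move=> gK; apply/esym/mkcoset_eq.
Qed.

Section OrbitMap.
Variables (X : gset G) (x : X).

(** The map sends [g G_x] to [g x]; any element of the coset gives the same
    value, which is [orbit_funE]. *)
Definition orbit_fun (A : orb (stab x)) : X := lact (repr (val A)) x.

Lemma orbit_funE g : orbit_fun (mkcoset (stab x) g) = lact g x.
Proof.
apply/esym/lact_eq; rewrite -mem_lcoset /=.
exact: mem_repr (lcoset_refl _ _).
Qed.

Lemma orbit_fun_subproof g (A : orb (stab x)) :
  orbit_fun (lact g A) = lact g (orbit_fun A).
Proof.
by case: (cosetP A) => h ->; rewrite lact_coset !orbit_funE lactM.
Qed.

Definition orbit_map : gmap (orb (stab x)) X := GMap orbit_fun_subproof.

Lemma orbit_map_inj : injective orbit_map.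
Proof.
move=> A B; case: (cosetP A) => g ->; case: (cosetP B) => h ->.
by rewrite /= !orbit_funE => /lact_eq/mkcoset_eq.
Qed.

End OrbitMap.

Lemma orbit_map_proj X Y (f : gmap X Y) (x : X) :
  gcomp f (orbit_map x) = gcomp (orbit_map (f x)) (proj (stab_sub f x)).
Proof.
apply: gmap_ext => A; case: (cosetP A) => g ->.
by rewrite /= proj_funE !orbit_funE gmapP.
Qed.

Section Transversal.
Variable X : gset G.

(** [choose] depends only on the extent of the predicate, so all points of an
    orbit get the same representative. *)
Definition orbit_rep (x : X) : X :=
  choose [pred y | [exists g, lact g y == x]] x.

Lemma orbit_repP x : exists g, lact g (orbit_rep x) = x.
Proof.
have x_in : [pred y : X | [exists g, lact g y == x]] x.
  by apply/existsP; exists 1; rewrite lact1.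
by have /existsP[g /eqP E] := chooseP x_in; exists g.
Qed.

Lemma orbit_rep_lact g x : orbit_rep (lact g x) = orbit_rep x.
Proof.
rewrite /orbit_rep.
have E : [pred y | [exists h, lact h y == lact g x]]
         =1 [pred y | [exists h, lact h y == x]].
  move=> y /=; apply/existsP/existsP=> -[h /eqP E].
    by exists (g^-1 * h); rewrite lactM E -lactM mulVg lact1.
  by exists (g * h); rewrite lactM E.
rewrite (eq_choose E); apply: choose_id => /=; apply/existsP.
  by exists g^-1; rewrite -lactM mulVg lact1.
by exists 1; rewrite lact1.
Qed.

(** The union runs over all points [x], not just over one in each orbit: [X]
    then need only be embedded in it as a retract, by [orbit_section], and no
    isomorphism of [X] with a union over its orbits has to be built. *)
Definition point_orbits : gset G := gsum (fun x : X => orb (stab x)).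

(** A point [x = g r] with representative [r] is sent to the coset [g G_r] in
    the summand of [r]; such a [g] exists by [orbit_repP], so the default
    value [1] does not occur. *)
Definition section_fun (x : X) : point_orbits :=
  Tagged (fun y : X => gset_sort (orb (stab y)))
    (mkcoset (stab (orbit_rep x))
             (odflt 1 [pick g | lact g (orbit_rep x) == x])).

(** The coset does not depend on the choice of [g].  Leaving [r] free lets
    equivariance be checked without transporting cosets between the equal
    summands of [orbit_rep (lact g x)] and [orbit_rep x]. *)
Lemma section_funE (r x : X) g : orbit_rep x = r -> lact g r = x ->
  section_fun x = gsum_inj (fun y : X => orb (stab y)) r (mkcoset _ g).
Proof.
move=> <- gx; rewrite /section_fun /=; congr Tagged; apply/mkcoset_eq/lact_eq.
by case: pickP => [h /eqP ->|/(_ g)]; rewrite gx ?eqxx.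
Qed.

Lemma section_fun_subproof g x :
  section_fun (lact g x) = lact g (section_fun x).
Proof.
have [h hx] := orbit_repP x.
rewrite (section_funE (erefl _) hx) -gmapP lact_coset.
by apply: section_funE; [exact: orbit_rep_lact | rewrite lactM hx].
Qed.

Definition orbit_section : gmap X point_orbits := GMap section_fun_subproof.

Lemma orbit_sectionK : gcomp (gsum_case (@orbit_map X)) orbit_section = gid X.
Proof.
apply: gmap_ext => x; have [h hx] := orbit_repP x.
rewrite /= -[LHS]/(gsum_case (@orbit_map X) (section_fun x)).
by rewrite (section_funE (erefl _) hx) [LHS]orbit_funE.
Qed.

Lemma orbit_section_inj : injective orbit_section.
Proof.
apply: (can_inj (g := gsum_case (@orbit_map X))) => x.
exact: (congr1 (fun k : gmap X X => k x) orbit_sectionK).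
Qed.

End Transversal.
End OrbitMaps.

(** * Indexing categories are determined by orbit projections *)

Section IndexingCategories.
Variable G : finGroupType.
Implicit Types (X Y Z : gset G) (K H : {group G}) (R : Tr G) (D : IndCat G).

(** The axiom only provides some coproduct of the [X i] to which copairing in
    [D] applies.  An arbitrary coproduct [C] is a retract of that one, hence
    embeds into it, and [D] contains embeddings. *)
Lemma case_indcat D (I : finType) (X : I -> gset G) C
    (inj : forall i, gmap (X i) C) Z (h : gmap C Z) :
  is_coproduct (all_morphisms (G := G)) inj ->
  (forall i, D _ _ (gcomp h (inj i))) -> D _ _ h.
Proof.
move=> [_ copC] Dh; have [_ Dcomp _ Dco] := indcatP D.
have [C' [inj' [[_ copC'] [_ copD]]]] := Dco I X.
have [h' [[Dh' Eh'] _]] := copD Z _ Dh.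
have [k [[_ Ek] _]] := copC C' inj' (fun _ => Logic.I).
have [l [[_ El] _]] := copC' C inj (fun _ => Logic.I).
have lk : gcomp l k = gid C.
  have [m [_ uniq_m]] := copC C inj (fun _ => Logic.I).
  rewrite -(uniq_m (gid C)); last by split=> // i; apply: gmap_ext.
  symmetry; apply: uniq_m; split=> // i.
  by rewrite -[RHS]El -Ek; apply: gmap_ext.
have -> : h = gcomp h' k.
  have [m [_ uniq_m]] := copC Z (fun i => gcomp h (inj i)) (fun _ => Logic.I).
  rewrite -(uniq_m h) //; apply: uniq_m; split=> // i.
  by rewrite -Eh' -Ek; apply: gmap_ext.
apply: Dcomp => //; apply: mono_indcat; apply: (can_inj (g := l)) => x.
exact: (congr1 (fun k : gmap C C => k x) lk).
Qed.

(** The square of [orbit_map_proj] compares the projection with the pullback of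
    [f] along [orbit_map (f x)]; the comparison map is an embedding because
    [orbit_map x] already is.  For the converse, [f] is the embedding
    [orbit_section X] followed by the map [point_orbits X -> Y] that [f] induces
    from the orbit maps. *)
Lemma indcat_stab D X Y (f : gmap X Y) :
  D _ _ f <-> forall x, D _ _ (proj (stab_sub f x)).
Proof.
have [_ Dcomp Dpb _] := indcatP D.
split=> [Df x|Dproj].
  pose E := orbit_map_proj f x.
  have -> : proj (stab_sub f x) = gcomp (pb_snd _ _) (pb_pair E).
    exact: gmap_ext.
  apply: (Dcomp); first exact: Dpb (gpbP _ _) Df.
  apply: mono_indcat => A B /(congr1 (pb_fst _ _)).
  exact: orbit_map_inj.
have -> : f = gcomp (gcomp f (gsum_case (@orbit_map G X))) (orbit_section X).
  apply: gmap_ext => x /=; congr (f _).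
  exact: (esym (congr1 (fun k : gmap X X => k x) (orbit_sectionK X))).
apply: (Dcomp); last exact/mono_indcat/orbit_section_inj.
apply: case_indcat => [|x]; first exact: gsum_coproduct.
have -> : gcomp (gcomp f (gsum_case (@orbit_map G X))) (gsum_inj _ x)
          = gcomp f (orbit_map x) by apply: gmap_ext.
rewrite orbit_map_proj.
by apply: (Dcomp); first exact/mono_indcat/orbit_map_inj.
Qed.

Lemma IndCat_ext D1 D2 : IndCat_le D1 D2 -> IndCat_le D2 D1 -> D1 = D2.
Proof.
case: D1 D2 => [D1 P1] [D2 P2] le12 le21.
have E : D1 = D2.
  apply: functional_extensionality_dep => X.
  apply: functional_extensionality_dep => Y.
  by apply/funext=> f; apply/propext; split=> [/le12|/le21].
by subst D2; congr MkIndCat; apply: Prop_irrelevance.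
Qed.

Lemma SetG_mono R1 R2 : Tr_le R1 R2 -> IndCat_le (SetG R1) (SetG R2).
Proof. by move=> le12 X Y f Rf x; apply/le12/Rf. Qed.

Lemma transfer_of_mono D1 D2 :
  IndCat_le D1 D2 -> Tr_le (transfer_of D1) (transfer_of D2).
Proof. by move=> le12 K H [sKH /le12 DKH]; exists sKH. Qed.

(** The base point of [G/K] gives back [R K H]; at the other points [R] is asked
    for conjugates of [K] and [H], where it holds by conjugation invariance. *)
Lemma SetG_proj R K H (sKH : K \subset H) : SetG R _ _ (proj sKH) <-> R K H.
Proof.
split=> [/(_ (mkcoset K 1))|RKH A].
  rewrite /= proj_funE !stab_mkcoset invg1.
  by congr (R _ _); apply: val_inj; rewrite /= conjsg1.
case: (cosetP A) => x ->; rewrite /= proj_funE !stab_mkcoset.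
exact: (ts_conj (transferP R)).
Qed.

Lemma SetGK : cancel (@SetG G) (@transfer_of G).
Proof.
move=> R; apply: Tr_ext => K H; first by case=> sKH /SetG_proj.
move=> RKH; have sKH := ts_sub (transferP R) RKH.
by exists sKH; apply/SetG_proj.
Qed.

Lemma transfer_ofK : cancel (@transfer_of G) (@SetG G).
Proof.
move=> D; apply: IndCat_ext => X Y f.
  move=> Df; apply/indcat_stab => x.
  (* The two inclusion proofs define the same projection. *)
  by have [sK DK] := Df x; rewrite (bool_irrelevance (stab_sub f x) sK).
by move=> /indcat_stab Df x; exists (stab_sub f x).
Qed.

End IndexingCategories.

Theorem corollary3p9 (G : finGroupType) :
  [/\ is_lattice (@Tr_le G) /\ is_lattice (@IndCat_le G),
      is_lattice_map (@Tr_le G) (@IndCat_le G) (@SetG G),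
      is_lattice_map (@IndCat_le G) (@Tr_le G) (@transfer_of G),
      cancel (@SetG G) (@transfer_of G) &
      cancel (@transfer_of G) (@SetG G)].
Proof.
have SG := @SetG_mono G; have TG := @transfer_of_mono G.
have SK := @SetGK G; have TK := @transfer_ofK G.
split=> //; [split | |]; first exact: Tr_lattice.
- exact: (iso_lattice SG TG SK TK (@Tr_lattice G)).
- exact: (iso_lattice_map SG TG SK TK).
- exact: (iso_lattice_map TG SG TK SK).
Qed.
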